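(* Let $G$ be a finite group, $E$ a Riesz space with sufficiently many projections and $\rho\colon G\to\mathrm{Aut}^+(E)$ a positive representation. Then the following are equivalent: (i) $\rho$ is order indecomposable; (ii) $\rho$ is projection band irreducible; (iii) $\rho$ is band irreducible; (iv) $\rho$ is ideal irreducible; (v) $\rho$ is principal band irreducible. If these equivalent conditions hold, then $E$ is finite dimensional, and the dimension of $E$ divides the order of $G$ if $E$ is nonzero.
   Context: All Riesz spaces (vector lattices) are real. $\mathrm{Aut}^+(E)$ denotes the group of lattice automorphisms of a Riesz space $E$. A positive representation of a group $G$ in $E$ is a group homomorphism $\rho\colon G\to\mathrm{Aut}^+(E)$, $s\mapsto\rho_s$. A subset $D\subset E$ is $\rho$-invariant if $\rho_s D\subset D$ for all $s\in G$. A Riesz space $E$ has sufficiently many projections if every nonzero band in $E$ contains a nonzero projection band. A positive representation $\rho$ is called band irreducible if every $\rho$-invariant band equals $\{0\}$ or $E$; projection band irreducible, ideal irreducible and principal band irreducible are defined in the same way, with ''band'' replaced by ''projection band'', ''ideal'' (order ideal) and ''principal band'' (a band generated by a single element), respectively. $\rho$ is called order indecomposable if there is no nontrivial order direct sum decomposition $E=L\oplus M$ with $L$ and $M$ both $\rho$-invariant; here $E=L\oplus M$ is an order direct sum if it is a direct sum of vector spaces in which $x+y$ ($x\in L$, $y\in M$) is positive if and only if $x$ and $y$ are both positive, and it is nontrivial if $L\neq 0$ and $L\neq E$. *)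

(* Defs.v *)
From HB Require Import structures.
From mathcomp Require Import all_boot all_order all_algebra fingroup.
From mathcomp Require Import boolp classical_sets reals.

Set Implicit Arguments.
Unset Strict Implicit.
Unset Printing Implicit Defensive.

Import Order.TTheory GRing.Theory Num.Theory.

Local Open Scope classical_set_scope.
Local Open Scope ring_scope.

HB.mixin Record POrder_Lmodule_isRiesz (R : realType) E
    of Order.POrder ring_display E & GRing.Lmodule R E := {
  riesz_leD2r : forall x y z : E, x <= y -> x + z <= y + z;
  riesz_scale_ge0 : forall (a : R) (x : E), 0 <= a -> 0 <= x -> 0 <= a *: x;
  riesz_meet : E -> E -> E;
  riesz_join : E -> E -> E;
  riesz_lexI : forall x y z : E,
    (x <= riesz_meet y z) = (x <= y) && (x <= z);
  riesz_leUx : forall x y z : E,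
    (riesz_join x y <= z) = (x <= z) && (y <= z)
}.

#[short(type="rieszType")]
HB.structure Definition Riesz (R : realType) :=
  {E of Order.POrder ring_display E & GRing.Lmodule R E &
        POrder_Lmodule_isRiesz R E}.

(* Order.Lattice is not a parent of Riesz because Hierarchy-Builder would then
   require a common refinement of Riesz and Num.RealDomain. *)
#[non_forgetful_inheritance]
HB.instance Definition _ (R : realType) (E : rieszType R) :=
  Order.POrder_isMeetSemilattice.Build ring_display (Riesz.sort E)
    (@riesz_lexI R E).
#[non_forgetful_inheritance]
HB.instance Definition _ (R : realType) (E : rieszType R) :=
  Order.POrder_isJoinSemilattice.Build ring_display (Riesz.sort E)
    (@riesz_leUx R E).

Section RieszSpace.
Context {R : realType} {E : rieszType R}.
Implicit Types (x y z : E) (A B D L M : set E).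

Definition riesz_abs x : E := (x `|` - x)%O.

Definition linear_subspace L : Prop := GRing.submod_closed (mem L).

Definition ideal A : Prop :=
  linear_subspace A /\ forall x y, A y -> riesz_abs x <= riesz_abs y -> A x.

(* Order closedness of an ideal, in the form: suprema in E of subsets of B
   belong to B. *)
Definition band B : Prop :=
  ideal B /\ forall D x, D `<=` B -> supremums D x -> B x.

Definition disjoint_complement B : set E :=
  [set x | forall y, B y -> (riesz_abs x `&` riesz_abs y)%O = 0].

(* The sum is automatically direct, as B and its disjoint complement always
   intersect in 0. *)
Definition projection_band B : Prop :=
  band B /\
  forall x, exists y z, [/\ B y, disjoint_complement B z & x = y + z].

Definition principal_band B : Prop :=
  exists x : E, B = smallest band [set x].

Definition order_direct_sum L M : Prop :=
  [/\ linear_subspace L, linear_subspace M,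
      (forall z, exists x y, [/\ L x, M y & z = x + y]),
      L `&` M = [set 0] &
      forall x y, L x -> M y -> (0 <= x + y <-> 0 <= x /\ 0 <= y)].

Definition lattice_automorphism (f : E -> E) : Prop :=
  [/\ linear f, bijective f, Order.meet_morphism f & Order.join_morphism f].

End RieszSpace.

Definition sufficiently_many_projections (R : realType) (E : rieszType R) :=
  forall B : set E, band B -> B <> [set 0] ->
  exists P : set E, [/\ projection_band P, P <> [set 0] & P `<=` B].

(* The homomorphism G -> Aut+(E), with Aut+(E) a group under composition. *)
Record positive_representation (R : realType) (E : rieszType R)
    (gT : finGroupType) (rho : gT -> E -> E) : Prop := {
  posrep_aut : forall s, lattice_automorphism (rho s);
  posrepM : forall s t x, rho (s * t)%g x = rho s (rho t x)
}.

Section Irreducibility.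
Context {R : realType} {E : rieszType R} {gT : finGroupType}.
Variable rho : gT -> E -> E.

Definition rep_invariant (D : set E) : Prop := forall s, rho s @` D `<=` D.

Definition irreducible_for (P : set E -> Prop) : Prop :=
  forall D, P D -> rep_invariant D -> D = [set 0] \/ D = setT.

Definition band_irreducible := irreducible_for band.
Definition projection_band_irreducible := irreducible_for projection_band.
Definition ideal_irreducible := irreducible_for ideal.
Definition principal_band_irreducible := irreducible_for principal_band.

Definition order_indecomposable : Prop :=
  ~ exists L M : set E,
      [/\ order_direct_sum L M, rep_invariant L, rep_invariant M,
          L <> [set 0] & L <> setT].

End Irreducibility.

Definition has_dimension (R : realType) (E : rieszType R) (n : nat) : Prop :=
  inhabited (Vector.axiom n E).

(* Main.v *)
Require Import Defs.
From HB Require Import structures.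
From mathcomp Require Import all_boot all_order all_algebra fingroup.
From mathcomp Require Import boolp classical_sets reals.

(* The argument is element-wise.  Sufficiently many projections force [E] to be
   Archimedean, since the infinitesimals relative to [u] form a band.  If [rho]
   is band irreducible, every positive [y] meets some translate of every positive
   [d] (otherwise the disjoint complement of the orbit of [d] is a nontrivial
   invariant band).  Meeting [y] successively with translates of the members of
   a disjoint family and using the pigeonhole principle on the translating group
   elements, one finds that disjoint families have at most [#|G|] members.  The
   members of a family of maximal size are atoms and form a basis of [E]; [G]
   permutes the lines they span, transitively, so their number divides [#|G|],
   and a nonzero invariant ideal contains all of them. *)

Set Implicit Arguments.
Unset Strict Implicit.
Unset Printing Implicit Defensive.

Import Order.TTheory GRing.Theory Num.Theory.

Local Open Scope ring_scope.

Section RieszTheory.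
Context {R : realType} {E : rieszType R}.
Implicit Types (x y z u v w : E) (a : R) (B D L M P : set E).

(** * Order and lattice arithmetic in a Riesz space *)

Lemma rlerD2r z x y : (x + z <= y + z) = (x <= y).
Proof.
apply/idP/idP => [h|]; last exact: riesz_leD2r.
by rewrite -(addrK z x) -(addrK z y); apply: riesz_leD2r.
Qed.

Lemma rlerD2l z x y : (z + x <= z + y) = (x <= y).
Proof. by rewrite ![z + _]addrC rlerD2r. Qed.

Lemma rlerD x y z w : x <= y -> z <= w -> x + z <= y + w.
Proof.
by move=> xy zw; apply: (@le_trans _ _ (y + z)); rewrite ?rlerD2r ?rlerD2l.
Qed.

Lemma raddr_ge0 x y : 0 <= x -> 0 <= y -> 0 <= x + y.
Proof. by move=> x0 y0; rewrite -(addr0 0); exact: rlerD. Qed.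

Lemma rsubr_ge0 x y : (0 <= y - x) = (x <= y).
Proof. by rewrite -(rlerD2r x 0) add0r subrK. Qed.

Lemma rlerBlDr x y z : (x - y <= z) = (x <= z + y).
Proof. by rewrite -(rlerD2r y (x - y)) subrK. Qed.

Lemma rlerBrDr x y z : (x <= y - z) = (x + z <= y).
Proof. by rewrite -(rlerD2r z x) subrK. Qed.

Lemma rlerN2 x y : (- x <= - y) = (y <= x).
Proof. by rewrite -(rsubr_ge0 (- x)) opprK addrC rsubr_ge0. Qed.

Lemma roppr_ge0 x : (0 <= - x) = (x <= 0).
Proof. by rewrite -[in LHS]oppr0 rlerN2. Qed.

Lemma rscaler_ge0 a x : 0 <= a -> 0 <= x -> 0 <= a *: x.
Proof. exact: riesz_scale_ge0. Qed.

Lemma rler_wpZ2l a x y : 0 <= a -> x <= y -> a *: x <= a *: y.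
Proof.
move=> a0; rewrite -(rsubr_ge0 x) -(rsubr_ge0 (a *: x)) -scalerBr.
exact: rscaler_ge0.
Qed.

Lemma rler_pZ2l a x y : 0 < a -> (a *: x <= a *: y) = (x <= y).
Proof.
move=> a0; apply/idP/idP => [h|]; last exact/rler_wpZ2l/ltW.
have ai0 : 0 <= a^-1 by rewrite invr_ge0 ltW.
by have := rler_wpZ2l ai0 h; rewrite !scalerA mulVf ?gt_eqF// !scale1r.
Qed.

Lemma rler_wpZ2r x a b : 0 <= x -> a <= b -> a *: x <= b *: x.
Proof.
by move=> x0 ab; rewrite -rsubr_ge0 -scalerBl rscaler_ge0// subr_ge0.
Qed.

Lemma rscaler_gt0 a x : 0 < a -> 0 < x -> 0 < a *: x.
Proof.
move=> a0 x0; rewrite lt_neqAle rscaler_ge0 ?ltW// andbT eq_sym scaler_eq0.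
by rewrite !gt_eqF.
Qed.

Lemma meetDr z x y : (x `&` y)%O + z = ((x + z) `&` (y + z))%O.
Proof.
apply/le_anti/andP; split; first by rewrite lexI !rlerD2r leIl leIr.
by rewrite -rlerBlDr lexI !rlerBlDr leIl leIr.
Qed.

Lemma joinDr z x y : (x `|` y)%O + z = ((x + z) `|` (y + z))%O.
Proof.
apply/le_anti/andP; split; last by rewrite leUx !rlerD2r leUl leUr.
by rewrite -rlerBrDr leUx !rlerBrDr leUl leUr.
Qed.

Lemma meetZr a x y : 0 < a -> a *: (x `&` y)%O = ((a *: x) `&` (a *: y))%O.
Proof.
move=> a0; have ai0 : 0 < a^-1 by rewrite invr_gt0.
have aK (z : E) : a *: (a^-1 *: z) = z.
  by rewrite scalerA divff ?gt_eqF// scale1r.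
apply/le_anti/andP; split; first by rewrite lexI !rler_pZ2l// leIl leIr.
rewrite -[leLHS]aK rler_pZ2l// lexI.
by apply/andP; split; rewrite -(rler_pZ2l _ _ a0) aK ?leIl ?leIr.
Qed.

Lemma opp_join x y : - (x `|` y)%O = (- x `&` - y)%O.
Proof.
apply/le_anti/andP; split; first by rewrite lexI !rlerN2 leUl leUr.
by rewrite -[leLHS]opprK rlerN2 leUx -rlerN2 opprK leIl -rlerN2 opprK leIr.
Qed.

(** Translating the join of [- x] and [- y] by [x + y] gives the join of [y] and [x]. *)
Lemma joinDmeet x y : (x `|` y)%O + (x `&` y)%O = x + y.
Proof.
have -> : (x `&` y)%O = - (- x `|` - y)%O by rewrite opp_join !opprK.
apply/eqP; rewrite subr_eq [in eqbRHS]addrC joinDr addKr.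
by rewrite [- y + _]addrC addrK joinC.
Qed.

(** * Absolute values and disjointness *)

Lemma riesz_abs_ge x : x <= riesz_abs x. Proof. exact: leUl. Qed.

Lemma riesz_abs_geN x : - x <= riesz_abs x. Proof. exact: leUr. Qed.

Lemma riesz_abs_le x y : (riesz_abs x <= y) = (x <= y) && (- x <= y).
Proof. exact: leUx. Qed.

Lemma riesz_absN x : riesz_abs (- x) = riesz_abs x.
Proof. by rewrite /riesz_abs opprK joinC. Qed.

Lemma riesz_abs_ge0 x : 0 <= riesz_abs x.
Proof.
have h : 0 <= riesz_abs x + riesz_abs x.
  by rewrite -(subrr x) rlerD// ?riesz_abs_ge ?riesz_abs_geN.
by rewrite -(rler_pZ2l _ _ (ltr0Sn R 1)) scaler0 scaler_nat mulr2n.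
Qed.

Lemma riesz_abs_ge0_id x : 0 <= x -> riesz_abs x = x.
Proof.
by move=> x0; apply/join_l; rewrite (le_trans _ x0)// -oppr0 rlerN2.
Qed.

Lemma riesz_abs_id x : riesz_abs (riesz_abs x) = riesz_abs x.
Proof. exact/riesz_abs_ge0_id/riesz_abs_ge0. Qed.

Lemma riesz_abs_le0 x : riesz_abs x <= 0 -> x = 0.
Proof.
rewrite riesz_abs_le -oppr0 rlerN2 oppr0 => /andP[x0 x0'].
exact/le_anti/andP.
Qed.

Lemma riesz_abs_gt0 x : x <> 0 -> 0 < riesz_abs x.
Proof.
move=> x0; rewrite lt_neqAle riesz_abs_ge0 andbT eq_sym; apply/eqP => h.
by apply/x0/riesz_abs_le0; rewrite h.
Qed.

Lemma riesz_abs0 : riesz_abs (0 : E) = 0.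
Proof. exact: riesz_abs_ge0_id. Qed.

Lemma riesz_absD x y : riesz_abs (x + y) <= riesz_abs x + riesz_abs y.
Proof.
by rewrite riesz_abs_le opprD !rlerD ?riesz_abs_ge ?riesz_abs_geN.
Qed.

Lemma riesz_absZ_le a x : riesz_abs (a *: x) <= `|a| *: riesz_abs x.
Proof.
wlog a0 : a x / 0 <= a.
  move=> h; have [/h//|a0] := leP 0 a.
  by rewrite -riesz_absN -scaleNr -normrN h// oppr_ge0 ltW.
rewrite ger0_norm// riesz_abs_le -scalerN.
by rewrite !rler_wpZ2l ?riesz_abs_ge ?riesz_abs_geN.
Qed.

Lemma meet_eq0_le x y z w : 0 <= x -> 0 <= y -> x <= z -> y <= w ->
  (z `&` w)%O = 0 -> (x `&` y)%O = 0.
Proof.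
move=> x0 y0 xz yw zw; apply/le_anti; rewrite lexI x0 y0 !andbT -zw.
exact: leI2.
Qed.

(** Distributing the sum on the right over its meets leaves terms each of which dominates [x + y] or
    [z]. *)
Lemma meetDl_le x y z : 0 <= x -> 0 <= y -> 0 <= z ->
  ((x + y) `&` z)%O <= (x `&` z)%O + (y `&` z)%O.
Proof.
move=> x0 y0 z0; rewrite meetDr lexI; apply/andP; split; last first.
  by apply: leIxr; rewrite -[leLHS]addr0 rlerD2l lexI y0.
rewrite [x + (_ `&` _)%O]addrC meetDr lexI [y + x]addrC leIl leIxr//.
by rewrite -[leLHS]addr0 rlerD2l.
Qed.

Lemma meetD_eq0 x y z : 0 <= x -> 0 <= y -> 0 <= z ->
  (x `&` z)%O = 0 -> (y `&` z)%O = 0 -> ((x + y) `&` z)%O = 0.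
Proof.
move=> x0 y0 z0 xz yz; apply/le_anti; rewrite lexI raddr_ge0// z0 !andbT.
by rewrite (le_trans (meetDl_le _ _ _))// xz yz addr0.
Qed.

Lemma meetZ_eq0 a x z : 0 <= a -> 0 <= x -> 0 <= z ->
  (x `&` z)%O = 0 -> ((a *: x) `&` z)%O = 0.
Proof.
(* The factor [a + 1] is positive and dominates both [a] and 1, so both arguments can be scaled by
   it at once. *)
move=> a0 x0 z0 xz; have m0 : 0 < a + 1 by rewrite ltr_wpDl.
apply: (@meet_eq0_le _ _ ((a + 1) *: x) ((a + 1) *: z)) => //.
- exact: rscaler_ge0.
- by rewrite rler_wpZ2r// lerDl.
- by rewrite -[leLHS]scale1r rler_wpZ2r// lerDr.
- by rewrite -meetZr// xz scaler0.
Qed.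

Definition pospart x : E := (x `|` 0)%O.

Lemma pospart_ge0 x : 0 <= pospart x. Proof. exact: leUr. Qed.

Lemma pospart_ge x : x <= pospart x. Proof. exact: leUl. Qed.

Lemma pospart_le x y : 0 <= y -> (pospart x <= y) = (x <= y).
Proof. by move=> y0; rewrite /pospart leUx y0 andbT. Qed.

Lemma pospart_eq0 x : pospart x = 0 -> x <= 0.
Proof. by move=> <-; exact: pospart_ge. Qed.

Lemma pospart_leabs x : pospart x <= riesz_abs x.
Proof. by rewrite pospart_le ?riesz_abs_ge0 ?riesz_abs_ge. Qed.

Lemma pospartBN x : pospart x - pospart (- x) = x.
Proof.
by rewrite /pospart opp_join opprK oppr0 joinDmeet addr0.
Qed.

(** Subtracting the negative part from both arguments turns the meet into that of [x] and 0, which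
    is minus the negative part. *)
Lemma pospart_disj x : (pospart x `&` pospart (- x))%O = 0.
Proof.
have := meetDr (- pospart (- x)) (pospart x) (pospart (- x)).
rewrite subrr pospartBN => /eqP; rewrite subr_eq => /eqP ->.
by rewrite -[X in (_ `&` X)%O]oppr0 -[x in (x `&` _)%O]opprK -opp_join addNr.
Qed.

(** Meeting [|y| <= |x + y| + |x|] with [|y|] removes the term [|x|]. *)
Lemma disj_abs_le x y : (riesz_abs x `&` riesz_abs y)%O = 0 ->
  riesz_abs y <= riesz_abs (x + y).
Proof.
move=> xy; have h : riesz_abs y <= riesz_abs (x + y) + riesz_abs x.
  rewrite -{1}(addKr x y) (le_trans (riesz_absD _ _))// riesz_absN addrC//.
rewrite -(meet_idPl h) meetC (le_trans (meetDl_le _ _ _)) ?riesz_abs_ge0//.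
by rewrite xy addr0 leIl.
Qed.

(** * Bands and disjoint complements *)

Lemma linear_subspaceP L : linear_subspace L <->
  L 0 /\ forall a x y, L x -> L y -> L (a *: x + y).
Proof.
split=> [[L0 LD]|[L0 LD]]; split=> [|a x y]; rewrite ?inE//.
- by move: L0; rewrite inE.
- by move=> Lx Ly; have := LD a x y; rewrite !inE; apply.
- exact: LD.
Qed.

Lemma linear_subspaceD L x y : linear_subspace L -> L x -> L y -> L (x + y).
Proof.
by move=> /linear_subspaceP[_ h] Lx Ly; rewrite -[x]scale1r; exact: h.
Qed.

Lemma linear_subspaceZ L a x : linear_subspace L -> L x -> L (a *: x).
Proof.
by move=> /linear_subspaceP[L0 h] Lx; rewrite -[_ *: _]addr0; exact: h.
Qed.

Lemma linear_subspaceN L x : linear_subspace L -> L x -> L (- x).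
Proof. by move=> hL Lx; rewrite -scaleN1r; exact: linear_subspaceZ. Qed.

Lemma linear_subspaceB L x y : linear_subspace L -> L x -> L y -> L (x - y).
Proof.
by move=> hL Lx Ly; apply: linear_subspaceD => //; exact: linear_subspaceN.
Qed.

Lemma linear_subspace0 L : linear_subspace L -> L 0.
Proof. by case/linear_subspaceP. Qed.

Lemma nonzero_in L : linear_subspace L -> L <> [set 0]%classic ->
  exists2 x, L x & x <> 0.
Proof.
move=> hL L0; apply: contrapT => h; apply: L0; apply/seteqP; split=> x /=.
  by move=> Lx; apply: contrapT => x0; apply: h; exists x.
by move=> ->; exact: linear_subspace0.
Qed.

Lemma ideal_abs A x : ideal A -> A x -> A (riesz_abs x).
Proof. by case=> _ h Ax; apply: (h _ x) => //; rewrite riesz_abs_id. Qed.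

Lemma ideal_le A x y : ideal A -> A y -> 0 <= x -> x <= y -> A x.
Proof.
move=> [_ h] Ay x0 xy; apply: h Ay _; rewrite riesz_abs_ge0_id//.
exact/(le_trans xy)/riesz_abs_ge.
Qed.

Lemma ideal_pospart A x : ideal A -> A x -> A (pospart x).
Proof.
move=> hA Ax; apply: (ideal_le hA (ideal_abs hA Ax)) (pospart_leabs _).
exact: pospart_ge0.
Qed.

Lemma disjoint_self B x : B x -> disjoint_complement B x -> x = 0.
Proof.
move=> Bx /(_ x Bx); rewrite meetxx => h.
by apply: riesz_abs_le0; rewrite h.
Qed.

Lemma disjoint_complement_ideal B : ideal (disjoint_complement B).
Proof.
split.
  apply/linear_subspaceP; split=> [y _|a x y hx hy z Bz].
    by rewrite riesz_abs0; apply/meet_l/riesz_abs_ge0.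
  have h0 := riesz_abs_ge0.
  apply: (meet_eq0_le _ _ (riesz_absD _ _) (lexx _)) => //.
  apply: meetD_eq0 => //; last exact: hy.
  apply: (meet_eq0_le _ _ (riesz_absZ_le _ _) (lexx _)) => //.
  by apply: meetZ_eq0 => //; exact: hx.
move=> x y hy xy z Bz.
by apply: (meet_eq0_le _ _ xy (lexx _)); rewrite ?riesz_abs_ge0//; exact: hy.
Qed.

Lemma supremumsP D x : supremums D x <->
  (forall d, D d -> d <= x) /\ (forall y, (forall d, D d -> d <= y) -> x <= y).
Proof. by []. Qed.

(** Every vector bounds the empty set, so [x] is a least vector and lies below both 0 and [x + x].
    The definition of [band] also quantifies over the empty set. *)
Lemma supremums_empty D x : ~ (exists d, D d) -> supremums D x -> x = 0.
Proof.
move=> D0 /supremumsP[_ lubx].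
have x_le y : x <= y by apply: lubx => d Dd; case: D0; exists d.
by apply/le_anti; rewrite x_le/= -(rlerD2r x) add0r x_le.
Qed.

(** The two parts of a supremum [x] are treated separately: the negative part lies below [|d0|] for
    any one member [d0], while the positive part needs the whole set [D]. *)
Lemma disjoint_complement_band B : band (disjoint_complement B).
Proof.
have hI := disjoint_complement_ideal B; split=> // D x DB supx.
have [ubx lubx] := (supremumsP D x).1 supx.
have [[d0 Dd0]|D0] := pselect (exists d, D d); last first.
  by rewrite (supremums_empty D0 supx); exact: linear_subspace0 hI.1.
have xNB : disjoint_complement B (pospart (- x)).
  apply: (ideal_le hI (ideal_abs hI (DB _ Dd0))); first exact: pospart_ge0.
  rewrite pospart_le ?riesz_abs_ge0//.
  by apply: le_trans (riesz_abs_geN _); rewrite rlerN2; exact: ubx.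
suff xPB : disjoint_complement B (pospart x).
  by have [hL _] := hI; rewrite -(pospartBN x); exact: linear_subspaceB hL _ _.
move=> y By; rewrite riesz_abs_ge0_id ?pospart_ge0//.
set w := (_ `&` _)%O.
have w0 : 0 <= w by rewrite lexI pospart_ge0 riesz_abs_ge0.
suff wx : w <= pospart (- x).
  by apply/le_anti; rewrite w0 andbT -(pospart_disj x) lexI wx leIl.
(* For [d] in [D], [w] and the positive part of [d] are disjoint and both below [pospart x], so
   their sum equals their join and is below it too. Hence [pospart x - w] bounds [D]. *)
suff: x <= pospart x - w by rewrite -[leLHS]pospartBN rlerD2l rlerN2.
apply: lubx => d Dd; rewrite rlerBrDr.
have dw : (pospart d `&` w)%O = 0.
  apply: (meet_eq0_le _ w0 (pospart_leabs d) (leIr _ _)).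
    exact: pospart_ge0.
  exact: DB.
apply: (@le_trans _ _ (pospart d + w)); first by rewrite rlerD2r pospart_ge.
rewrite -joinDmeet dw addr0 leUx leIl andbT pospart_le ?pospart_ge0//.
exact: le_trans (ubx _ Dd) (pospart_ge _).
Qed.

(** * Projection bands and order direct sums *)

(** If [0 <= u + v], the negative part of each summand is below the positive part of the other, so
    it lies in both [P] and its complement and vanishes. *)
Lemma projection_band_order_direct_sum P : projection_band P ->
  order_direct_sum P (disjoint_complement P).
Proof.
move=> [[hP _] Pdec]; have hPd := disjoint_complement_ideal P.
have [[linP _] [linPd _]] := (hP, hPd).
split=> // [|x y Px Py].
  apply/seteqP; split=> [x [Px /(disjoint_self Px)]//|_ ->].
  by split; exact: linear_subspace0.
split=> [xy0|[]]; last exact: raddr_ge0.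
have opp_part u v : P u -> disjoint_complement P v -> 0 <= u + v ->
    pospart (- u) = 0 /\ pospart (- v) = 0.
  move=> Pu Pv uv0.
  have uv : pospart (- u) <= pospart v.
    rewrite pospart_le ?pospart_ge0//; apply: le_trans (pospart_ge _).
    by rewrite -(rlerD2l u) subrr.
  have vu : pospart (- v) <= pospart u.
    rewrite pospart_le ?pospart_ge0//; apply: le_trans (pospart_ge _).
    by rewrite -(rlerD2r v) addNr.
  have Pu' := ideal_pospart hP (linear_subspaceN linP Pu).
  have Pv' := ideal_pospart hPd (linear_subspaceN linPd Pv).
  split.
    apply: (disjoint_self Pu').
    by apply: (ideal_le hPd (ideal_pospart hPd Pv)) uv; exact: pospart_ge0.
  apply: disjoint_self Pv'.
  by apply: (ideal_le hP (ideal_pospart hP Pu)) vu; exact: pospart_ge0.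
have [/pospart_eq0 x0 /pospart_eq0 y0] := opp_part x y Px Py xy0.
by rewrite -[x]opprK -[y]opprK !roppr_ge0.
Qed.

Lemma order_direct_sumC L M : order_direct_sum L M -> order_direct_sum M L.
Proof.
move=> [hL hM dec LM pos]; split=> // [z||x y Mx Ly].
- by have [x [y [Lx My ->]]] := dec z; exists y, x; rewrite addrC.
- by rewrite setIC.
- by rewrite addrC; apply: iff_trans (pos y x Ly Mx) (and_comm _ _).
Qed.

(** Write [|x| = l + m]. Comparing components in [x <= |x|] and [- x <= |x|] shows that [l]
    dominates [|x|] and [m] is positive, so [l = |x|]. *)
Lemma order_direct_sum_abs L M x : order_direct_sum L M -> L x ->
  L (riesz_abs x).
Proof.
move=> [hL hM dec LM pos] Lx.
have [l [m [Ll Mm xlm]]] := dec (riesz_abs x).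
have h y : L y -> y <= riesz_abs x -> y <= l /\ 0 <= m.
  move=> Ly; rewrite xlm -rsubr_ge0 addrAC => h.
  by have [] := (pos _ _ (linear_subspaceB hL Ll Ly) Mm).1 h; rewrite rsubr_ge0.
have [xl m0] := h _ Lx (riesz_abs_ge x).
have [nxl _] := h _ (linear_subspaceN hL Lx) (riesz_abs_geN x).
have lx : l = riesz_abs x.
  by apply/le_anti; rewrite riesz_abs_le xl nxl xlm -[leLHS]addr0 rlerD2l m0.
by rewrite -lx.
Qed.

(** This makes the summands of an order direct sum bands. For [x] in [L] and [y] in [M], the meet of
    [|x|] and [|y|] has no [M]-component, being below [|x|], and no [L]-component, being below
    [|y|]. *)
Lemma order_direct_sum_complement L M : order_direct_sum L M ->
  L = disjoint_complement M.
Proof.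
move=> hLM; have [hL hM dec LM pos] := hLM.
have sub x : L x -> disjoint_complement M x.
  move=> Lx y My.
  have [l [m [Ll Mm wlm]]] := dec (riesz_abs x `&` riesz_abs y)%O.
  have Lx' := order_direct_sum_abs hLM Lx.
  have My' := order_direct_sum_abs (order_direct_sumC hLM) My.
  have [l0 m0] : 0 <= l /\ 0 <= m.
    by apply/(pos _ _ Ll Mm); rewrite -wlm lexI !riesz_abs_ge0.
  have lw : l + m <= riesz_abs x by rewrite -wlm leIl.
  have mw : l + m <= riesz_abs y by rewrite -wlm leIr.
  have [_ m0'] : 0 <= riesz_abs x - l /\ 0 <= - m.
    apply/pos; [exact: linear_subspaceB|exact: linear_subspaceN|].
    by rewrite -addrA -opprD rsubr_ge0.
  have [l0' _] : 0 <= - l /\ 0 <= riesz_abs y - m.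
    apply/pos; [exact: linear_subspaceN|exact: linear_subspaceB|].
    by rewrite addrC -addrA -opprD rsubr_ge0 addrC.
  rewrite wlm; have -> : l = 0 by apply/le_anti; rewrite l0 -roppr_ge0 l0'.
  have -> : m = 0 by apply/le_anti; rewrite m0 -roppr_ge0 m0'.
  by rewrite addr0.
(* Conversely, if [z = l + m] is disjoint from [M], then so is [m = z - l], an element of [M]. *)
apply/seteqP; split=> // z Mz.
have [l [m [Ll Mm zlm]]] := dec z; rewrite zlm.
have [linMd _] := disjoint_complement_ideal M.
suff -> : m = 0 by rewrite addr0.
apply: (disjoint_self Mm); rewrite -(addKr l m) -zlm.
by apply: (linear_subspaceD linMd) Mz; exact/(linear_subspaceN linMd)/sub.
Qed.

(** * The Archimedean property and atoms *)

Definition infinitesimals u : set E :=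
  [set w | forall n, n%:R *: riesz_abs w <= u]%classic.

Lemma infinitesimals_band u : 0 <= u -> band (infinitesimals u).
Proof.
move=> u0; have hI : ideal (infinitesimals u).
  split.
    apply/linear_subspaceP; split=> [n|a x y hx hy n].
      by rewrite riesz_abs0 scaler0.
    (* Doubling both sides provides one copy of [u] for each summand. *)
    rewrite -(rler_pZ2l _ _ (ltr0Sn R 1)).
    have ra0 : 0 <= (2 * n)%:R * `|a| by rewrite mulr_ge0.
    have h1 : (2 * n)%:R * `|a| *: riesz_abs x <= u.
      apply: le_trans (hx (Num.bound ((2 * n)%:R * `|a|))).
      by rewrite rler_wpZ2r ?riesz_abs_ge0// ltW// archi_boundP.
    rewrite [leRHS]scaler_nat mulr2n; apply: le_trans (rlerD h1 (hy (2 * n)%N)).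
    rewrite natrM -!scalerA -!scalerDr rler_pZ2l; last exact: (ltr0Sn R 1).
    rewrite rler_wpZ2l//; apply: le_trans (riesz_absD _ _) _.
    by rewrite rlerD2r riesz_absZ_le.
  move=> x y hy xy n; apply: le_trans (hy n).
  exact: rler_wpZ2l.
split=> // D x Du supx; have [ubx lubx] := (supremumsP D x).1 supx.
have [[d0 Dd0]|D0] := pselect (exists d, D d); last first.
  by rewrite (supremums_empty D0 supx); exact: linear_subspace0 hI.1.
case=> [|n]; first by rewrite scale0r.
have n0 : 0 < n.+1%:R :> R by [].
have abs_le w v : w <= n.+1%:R^-1 *: v -> n.+1%:R *: w <= v.
  by rewrite -(rler_pZ2l _ _ n0) scalerA divff ?gt_eqF// scale1r.
have le_abs w : n.+1%:R *: riesz_abs w <= u ->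
    w <= n.+1%:R^-1 *: u /\ - w <= n.+1%:R^-1 *: u.
  move=> h; apply/andP; rewrite -riesz_abs_le -(rler_pZ2l _ _ n0) scalerA.
  by rewrite divff ?gt_eqF// scale1r.
(* The bound on [x] comes from its being a least upper bound, the bound on [- x] from the single
   member [d0]. *)
apply: abs_le; rewrite riesz_abs_le lubx => [|d Dd].
  by have [_ h] := le_abs _ (Du _ Dd0 n.+1); apply: le_trans h;
    rewrite rlerN2 ubx.
by have [] := le_abs _ (Du _ Dd n.+1).
Qed.

Definition archimedean := forall u v, 0 <= v ->
  (forall n, n%:R *: v <= u) -> v = 0.

(** Otherwise a nonzero projection band [P] consists of infinitesimals relative to [u]. Projecting
    onto [P] replaces the bound [u] by its component [u1], which is itself infinitesimal. *)
Lemma sufficiently_many_projections_archimedean :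
  sufficiently_many_projections E -> archimedean.
Proof.
move=> hE u v v0 vu; apply: contrapT => vn0.
have u0 : 0 <= u by have := vu 0; rewrite scale0r.
have hI := infinitesimals_band u0.
have [|P [hP P0 PI]] := hE _ hI.
  move=> I0; have : infinitesimals u v by move=> n; rewrite riesz_abs_ge0_id.
  by rewrite I0.
have [[[linP _] _] Pdec] := hP.
have [p Pp pn0] := nonzero_in linP P0.
have [_ linPd _ _ pos] := projection_band_order_direct_sum hP.
have [u1 [u2 [Pu1 Pu2 uE]]] := Pdec u.
have le_u1 n y : P y -> n%:R *: y <= u -> n%:R *: y <= u1.
  move=> Py; rewrite uE -rsubr_ge0 addrAC => h; rewrite -rsubr_ge0.
  apply: ((pos _ _ _ Pu2).1 h).1; apply: (linear_subspaceB linP Pu1).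
  exact: linear_subspaceZ.
(* Since [u1] lies in [P], twice [u1] is below [u], hence below [u1]. *)
have u10 : u1 <= 0.
  rewrite -(rlerD2r u1) add0r -mulr2n -scaler_nat; apply: le_u1 => //.
  apply: le_trans (PI _ Pu1 2); rewrite rler_wpZ2l//; exact: riesz_abs_ge.
apply/pn0/riesz_abs_le0/(le_trans _ u10).
rewrite -[leLHS](scale1r); apply: (le_u1 1); last exact: (PI _ Pp 1).
exact: (ideal_abs hP.1.1).
Qed.

(** Indecomposability into disjoint parts is what a disjoint family of maximal size provides
    directly. Under the Archimedean property it forces the order interval from 0 to [e] to consist
    of multiples of [e]. *)
Definition riesz_atom e := 0 < e /\ forall y z, 0 <= y -> y <= e ->
  0 <= z -> z <= e -> (y `&` z)%O = 0 -> y = 0 \/ z = 0.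

(** The coefficient is the supremum of all [a >= 0] with [a *: e <= y], finite by the Archimedean
    property. What remains of [y] contains no further multiple of [e], and an atom then has to be
    disjoint from it. *)
Lemma riesz_atom_component e y : archimedean -> riesz_atom e -> 0 <= y ->
  exists a, [/\ 0 <= a, a *: e <= y & ((y - a *: e) `&` e)%O = 0].
Proof.
move=> hA [e0 he] y0; have e0' := ltW e0.
pose S := [set a : R | 0 <= a /\ a *: e <= y]%classic.
have S0 : S 0 by split=> //; rewrite scale0r.
have hsS : has_sup S.
  split; first by exists 0.
  apply: contrapT => noub; suff e00 : e = 0 by rewrite e00 ltxx in e0.
  apply: (hA y e e0') => n; apply: contrapT => ney; apply: noub.
  exists n%:R => a [a0 ay]; rewrite leNgt; apply/negP => na.
  by apply: ney; apply: le_trans ay; rewrite rler_wpZ2r// ltW.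
have a0 : 0 <= sup S by apply: ub_le_sup => //; exact: hsS.2.
have scale_le n w : w <= n.+1%:R^-1 *: e -> n.+1%:R *: w <= e.
  by rewrite -(rler_pZ2l _ _ (ltr0Sn R n)) scalerA divff ?scale1r// pnatr_eq0.
have invn n : 0 < n.+1%:R^-1 :> R by rewrite invr_gt0.
have aey : sup S *: e <= y.
  rewrite -[leRHS]add0r -rlerBlDr.
  (* The supremum is attained: the positive part of [sup S *: e - y] is below [e / (n + 1)] for
     every [n]. *)
  apply: pospart_eq0; apply: (hA e) => [|[|n]]; first exact: pospart_ge0.
    by rewrite scale0r.
  apply: scale_le; rewrite pospart_le; last by rewrite rscaler_ge0 // ltW.
  have [a [_ ay] /ltW ltab] := sup_adherent (invn n) hsS.
  rewrite rlerBlDr; apply: (@le_trans _ _ (n.+1%:R^-1 *: e + a *: e)).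
    by rewrite -scalerDl rler_wpZ2r// -lerBlDl.
  by rewrite rlerD2l.
exists (sup S); split=> //; set w := (_ `&` _)%O.
have w0 : 0 <= w by rewrite lexI rsubr_ge0 aey.
apply: (hA e) => // -[|n]; first by rewrite scale0r.
(* With [d = 1 / (n + 1) <= 1], the positive and negative parts of [w - d *: e] are disjoint and
   below the atom [e], so one of them vanishes. *)
apply: scale_le; set d := _^-1; have d0 : 0 < d by exact: invn.
have d1 : d <= 1 by rewrite invf_le1// ler1n.
have [] := he _ _ (pospart_ge0 (w - d *: e)) _ (pospart_ge0 (- (w - d *: e))) _
  (pospart_disj _).
- rewrite pospart_le// rlerBlDr (@le_trans _ _ e) ?leIr//.
  by rewrite -[leLHS]addr0 rlerD2l rscaler_ge0// ltW.
- rewrite pospart_le// opprB rlerBlDr (@le_trans _ _ e)//.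
    by rewrite -[leRHS]scale1r rler_wpZ2r.
  by rewrite -[leLHS]addr0 rlerD2l.
- by move=> /pospart_eq0; rewrite rlerBlDr add0r.
(* The case [d *: e <= w] would put [sup S + d] into [S]. *)
move=> /pospart_eq0; rewrite opprB rlerBlDr add0r => dw.
suff : S (sup S + d).
  by move=> /(ub_le_sup hsS.2); rewrite gerDl leNgt d0.
split; first by rewrite addr_ge0// ltW.
by rewrite scalerDl addrC -rlerBrDr (le_trans dw)// leIl.
Qed.

(** Here the remainder [y - a *: e] is itself below [e], so its meet with [e] is the remainder. *)
Lemma riesz_atom_le e y : archimedean -> riesz_atom e -> 0 <= y -> y <= e ->
  exists2 a, 0 <= a & y = a *: e.
Proof.
move=> hA he y0 ye; have [a [a0 aey h]] := riesz_atom_component hA he y0.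
exists a => //; apply/eqP; rewrite -subr_eq0 -h eq_sym; apply/eqP/meet_l.
rewrite rlerBlDr (le_trans ye)// -[leLHS]addr0 rlerD2l rscaler_ge0//.
exact/ltW/he.1.
Qed.

(** * Finite maximal disjoint families *)

Definition disjoint_family k (x : 'I_k -> E) :=
  (forall i, 0 < x i) /\ forall i j, i != j -> (x i `&` x j)%O = 0.

Lemma disjoint_family_extend k (x : 'I_k -> E) w : disjoint_family x -> 0 < w ->
  (forall i, (w `&` x i)%O = 0) -> exists x' : 'I_k.+1 -> E, disjoint_family x'.
Proof.
move=> [x0 xx] w0 wx; exists (fun h => oapp x w (unlift ord0 h)).
split=> [i|i j]; first by case: unliftP => [i' _|_] /=.
case: unliftP => [i' ->|->]; case: unliftP => [j' ->|->] //=.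
- by rewrite (inj_eq lift_inj) => /xx.
- by rewrite meetC.
Qed.

Definition maximal_disjoint_family k (x : 'I_k -> E) := disjoint_family x /\
  forall w, 0 <= w -> (forall i, (w `&` x i)%O = 0) -> w = 0.

(** A family of the largest possible size [k] works: if a member had two disjoint nonzero parts,
    replacing it by one and adding the other would give [k + 1] disjoint elements. *)
Lemma exists_maximal_atoms N :
  (forall k (x : 'I_k -> E), disjoint_family x -> (k <= N)%N) ->
  exists k (x : 'I_k -> E),
    maximal_disjoint_family x /\ forall i, riesz_atom (x i).
Proof.
move=> hN; pose P k := `[< exists x : 'I_k -> E, disjoint_family x >].
have P0 : exists k, P k.
  by exists 0%N; apply/asboolP; exists (fun=> 0); split=> -[].
have [|k /asboolP[x hx] kmax] := @ex_maxnP P N P0.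
  by move=> k /asboolP[x /hN].
(* Stated for every disjoint family of size [k], as it is applied both to [x] and to the modified
   family [x']. *)
have nofam w (z : 'I_k -> E) : disjoint_family z -> 0 <= w ->
    (forall i, (w `&` z i)%O = 0) -> w = 0.
  move=> hz w0 wz; apply/eqP; apply: contraT => wn0.
  have [|z' hz'] := disjoint_family_extend hz _ wz; first by rewrite lt_def wn0.
  have : (k.+1 <= k)%N by apply: kmax; apply/asboolP; exists z'.
  by rewrite ltnn.
exists k, x; split; first by split=> // w; exact: nofam.
have [x0 xx] := hx; move=> i; split=> // y z y0 yx z0 zx yz.
have [->|zn0] := eqVneq z 0; [by right|left].
pose x' j := if j == i then z else x j.
have z0' : 0 < z by rewrite lt_def zn0.
have zj j : j != i -> (z `&` x j)%O = 0.
  rewrite eq_sym => ij; apply: (meet_eq0_le z0 (ltW (x0 j)) zx (lexx _)).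
  exact: xx.
apply: (@nofam _ x') => // [|j]; last first.
  rewrite /x'; case: eqVneq => // ji.
  by apply: (meet_eq0_le y0 (ltW (x0 j)) yx (lexx _)); rewrite xx// eq_sym.
split=> [j|j l]; first by rewrite /x'; case: ifP.
rewrite /x'; case: (eqVneq j i) => [->|ji]; case: (eqVneq l i) => [_|li] // jl.
- exact: zj.
- by rewrite meetC zj.
- exact: xx.
Qed.

(** * Coordinates with respect to a maximal disjoint family of atoms *)

Section AtomBasis.
Variables (k : nat) (x : 'I_k -> E).

Definition lincomb (c : 'rV[R]_k) : E := \sum_i c 0 i *: x i.

Lemma lincomb_linear : linear lincomb.
Proof.
move=> a c d; rewrite /lincomb scaler_sumr -big_split/=.
by apply: eq_bigr => i _; rewrite !mxE scalerDl scalerA.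
Qed.

HB.instance Definition _ :=
  GRing.isLinear.Build R 'rV[R]_k E _ lincomb lincomb_linear.

Lemma lincomb_delta i : lincomb (delta_mx 0 i) = x i.
Proof.
rewrite /lincomb (bigD1 i)//= big1 => [|j ji]; last first.
  by rewrite mxE (negPf ji) andbF scale0r.
by rewrite mxE !eqxx scale1r addr0.
Qed.

(** In a vanishing combination, a term with nonzero coefficient is minus the sum of the others, so
    [x i] would be disjoint from itself. *)
Lemma lincomb_inj : disjoint_family x -> injective lincomb.
Proof.
move=> [x0 xx]; suff h c : lincomb c = 0 -> c = 0.
  move=> c d cd; apply/eqP; rewrite -subr_eq0; apply/eqP/h.
  by rewrite linearB /= cd subrr.
move=> c0; apply/rowP => i; rewrite !mxE; apply/eqP; apply: contraT => cin0.
pose S : set E := [set x i]%classic.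
have [linS _] := disjoint_complement_ideal S.
have: disjoint_complement S (\sum_(j | j != i) c 0 j *: x j).
  apply: (big_ind (disjoint_complement S)) => [|u v|j ji].
  - exact: linear_subspace0 linS.
  - exact: linear_subspaceD linS.
  - by apply: (linear_subspaceZ _ linS) => _ ->; rewrite !riesz_abs_ge0_id ?ltW ?xx.
move: c0; rewrite /lincomb (bigD1 i)//= => /eqP; rewrite addr_eq0 => /eqP cE.
move=> /(linear_subspaceN linS); rewrite -cE => /(linear_subspaceZ (c 0 i)^-1 linS).
rewrite scalerA mulVf// scale1r => /(@disjoint_self S (x i) erefl) xi0.
by have := x0 i; rewrite xi0 ltxx.
Qed.

(** The components of a positive [y] along the atoms are subtracted one by one. The final remainder
    is disjoint from every atom and vanishes by maximality. *)
Lemma lincomb_surj : archimedean -> maximal_disjoint_family x ->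
  (forall i, riesz_atom (x i)) -> forall y, exists c, y = lincomb c.
Proof.
move=> hA [[x0 xx] xmax] hx.
suff pos y : 0 <= y -> exists c, y = lincomb c.
  move=> y; rewrite -(pospartBN y).
  have [c ->] := pos _ (pospart_ge0 y); have [d ->] := pos _ (pospart_ge0 (- y)).
  by exists (c - d); rewrite linearB.
move=> y0; suff [c [z0 /(xmax _ z0)/eqP]] : exists c, 0 <= y - lincomb c /\
    forall i, ((y - lincomb c) `&` x i)%O = 0.
  by rewrite subr_eq0 => /eqP ->; exists c.
suff [c [z0 zx]] : exists c, 0 <= y - lincomb c /\
    {in enum 'I_k, forall i, ((y - lincomb c) `&` x i)%O = 0}.
  by exists c; split=> // i; apply: zx; rewrite mem_enum.
elim: (enum 'I_k) => [|i l [c [z0 zx]]].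
  by exists 0; rewrite linear0 subr0.
have [a [a0 az zi]] := riesz_atom_component hA (hx i) z0.
exists (c + a *: delta_mx 0 i); rewrite linearD linearZ/= lincomb_delta.
rewrite opprD addrA rsubr_ge0; split=> // j; rewrite inE.
have [->//|_/= jl] := eqVneq j i.
(* The new remainder is smaller than the old one, so it stays disjoint from the atoms already
   handled. *)
apply: (meet_eq0_le _ (ltW (x0 j)) _ (lexx _) (zx _ jl)); rewrite ?rsubr_ge0//.
by rewrite -[leRHS]subr0 rlerD2l rlerN2 rscaler_ge0// ltW.
Qed.

(** Coordinates are obtained by choice; they inherit linearity from the injectivity of [lincomb]. *)
Lemma lincomb_has_dimension : archimedean -> maximal_disjoint_family x ->
  (forall i, riesz_atom (x i)) -> has_dimension E k.
Proof.
move=> hA hm hx; have inj := lincomb_inj hm.1.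
have [coord coordE] := choice (lincomb_surj hA hm hx).
have coordK c : coord (lincomb c) = c by apply: inj; rewrite -coordE.
constructor; exists coord; last by exists lincomb => // y; rewrite -coordE.
by move=> a u v; apply: inj; rewrite linearP/= -!coordE.
Qed.

End AtomBasis.

End RieszTheory.

(** * Lattice automorphisms and positive representations *)

Section LatticeAutomorphism.
Context {R : realType} {E : rieszType R}.
Variables (f : E -> E) (hf : lattice_automorphism f).
Implicit Types (x y : E) (a : R).

Lemma lattice_automorphismZD a x y : f (a *: x + y) = a *: f x + f y.
Proof. by case: hf => lf _ _ _; rewrite lf. Qed.

Lemma lattice_automorphismD x y : f (x + y) = f x + f y.
Proof. by rewrite -[x]scale1r lattice_automorphismZD !scale1r. Qed.

Lemma lattice_automorphism0 : f 0 = 0.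
Proof. by apply: (addrI (f 0)); rewrite -lattice_automorphismD !addr0. Qed.

Lemma lattice_automorphismZ a x : f (a *: x) = a *: f x.
Proof.
by rewrite -[a *: x]addr0 lattice_automorphismZD lattice_automorphism0 addr0.
Qed.

Lemma lattice_automorphismN x : f (- x) = - f x.
Proof. by rewrite -!scaleN1r lattice_automorphismZ. Qed.

Lemma lattice_automorphism_inj : injective f.
Proof. by case: hf => _ /bij_inj. Qed.

Lemma lattice_automorphismI x y : f (x `&` y)%O = (f x `&` f y)%O.
Proof. by case: hf => _ _ hI _; exact: hI. Qed.

Lemma lattice_automorphism_le x y : (f x <= f y) = (x <= y).
Proof.
apply/meet_idPl/meet_idPl; rewrite -lattice_automorphismI; last by move=> ->.
exact: lattice_automorphism_inj.
Qed.

Lemma lattice_automorphism_abs x : f (riesz_abs x) = riesz_abs (f x).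
Proof.
by case: (hf) => _ _ _ hU; rewrite /riesz_abs hU lattice_automorphismN.
Qed.

Lemma lattice_automorphism_gt0 x : (0 < f x) = (0 < x).
Proof.
rewrite !lt_def -{2}lattice_automorphism0 lattice_automorphism_le.
by rewrite -{1}lattice_automorphism0 (inj_eq lattice_automorphism_inj).
Qed.

End LatticeAutomorphism.

(** * Positive representations and invariant sets *)

Section Representation.
Context {R : realType} {E : rieszType R} {gT : finGroupType}.
Variables (rho : gT -> E -> E) (hrho : positive_representation rho).
Implicit Types (x y : E) (s g : gT) (B D L : set E).

Let haut s := posrep_aut hrho s.

Lemma posrep1 x : rho 1%g x = x.
Proof.
by apply: (lattice_automorphism_inj (haut 1%g)); rewrite -posrepM// mulg1.
Qed.

Lemma posrepK s : cancel (rho s) (rho s^-1%g).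
Proof. by move=> x; rewrite -posrepM// mulVg posrep1. Qed.

Lemma posrepVK s : cancel (rho s^-1%g) (rho s).
Proof. by move=> x; rewrite -posrepM// mulgV posrep1. Qed.

Lemma rep_invariantP D : rep_invariant rho D <->
  forall s x, D x -> D (rho s x).
Proof.
split=> h s x; first by move=> Dx; apply: (h s); exists x.
by case=> y Dy <-; exact: h.
Qed.

Lemma disjoint_complement_invariant B :
  rep_invariant rho B -> rep_invariant rho (disjoint_complement B).
Proof.
move=> /rep_invariantP hB; apply/rep_invariantP => s x hx y By.
rewrite -(posrepVK s y) -!(lattice_automorphism_abs (haut s)).
rewrite -(lattice_automorphismI (haut s)) hx ?(lattice_automorphism0 (haut s))//.
exact: hB.
Qed.

(** As an order isomorphism, [rho s] carries suprema to suprema. This serves to show that the band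
    generated by a fixed vector is invariant. *)
Lemma band_preimage s B : band B -> band [set y | B (rho s y)]%classic.
Proof.
move=> [[linB solB] supB]; split; first split.
- apply/linear_subspaceP => /=; rewrite (lattice_automorphism0 (haut s)).
  split=> [|a x y Bx By]; first exact: linear_subspace0.
  rewrite (lattice_automorphismZD (haut s)).
  by apply: linear_subspaceD => //; exact: linear_subspaceZ.
- move=> x y /= By xy; apply: solB By _.
  by rewrite -!(lattice_automorphism_abs (haut s)) (lattice_automorphism_le (haut s)).
- move=> D x DB /supremumsP[ubx lubx] /=.
  apply: (supB (rho s @` D)%classic) => [_ [d Dd <-]|]; first exact: DB.
  apply/supremumsP; split=> [_ [d Dd <-]|y uby].
    by rewrite (lattice_automorphism_le (haut s)) ubx.
  rewrite -(posrepVK s y) (lattice_automorphism_le (haut s)).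
  apply: lubx => d Dd; rewrite -(lattice_automorphism_le (haut s)) posrepVK.
  by apply: uby; exists d.
Qed.

Lemma smallest_bandP (x : E) :
  let Bx := smallest band [set x]%classic in
  [/\ band Bx, Bx x & forall B, band B -> B x -> (Bx `<=` B)%classic].
Proof.
move=> Bx; split.
- split; first split.
  + apply/linear_subspaceP; split=> [B [[[linB _] _] _]|a y z hy hz B hB].
      exact: linear_subspace0.
    have [[[linB _] _] _] := hB.
    by apply: linear_subspaceD; [|apply: linear_subspaceZ; [|exact: hy]|exact: hz].
  + by move=> y z hz yz B hB; have [[[_ solB] _] _] := hB; apply: solB yz; exact: hz.
  + move=> D y hD hy B hB; have [[_ supB] _] := hB; apply: (supB D) => // z Dz.
    exact: hD.
- by move=> B [_]; apply.
- by move=> B hB xB y; apply; split=> // _ ->.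
Qed.

(** * Implications between the irreducibility conditions *)

Lemma order_indecomposable_projection_band :
  order_indecomposable rho -> projection_band_irreducible rho.
Proof.
move=> hI P hP invP; apply: contrapT => /not_orP[P0 PT]; apply: hI.
exists P, (disjoint_complement P); split=> //.
  exact: projection_band_order_direct_sum.
exact: disjoint_complement_invariant.
Qed.

(** The union of the bands [rho s^-1 P] for [s] in [l]. No span is taken, since only the disjoint
    complement of this set matters. *)
Definition translates P (l : seq gT) : set E :=
  [set y | exists2 s, s \in l & P (rho s y)]%classic.

(* The components in the translates of [P] are split off one after the other. *)
Lemma translates_decomposition B P (l : seq gT) :
  ideal B -> rep_invariant rho B ->
  projection_band P -> (P `<=` B)%classic ->
  let C := disjoint_complement (translates P l) in
  forall x, exists p c, [/\ B p, disjoint_complement C p, C c & x = p + c].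
Proof.
move=> hB /rep_invariantP invB [[[linP solP] _] Pdec] PB /=.
have [linB _] := hB.
elim: l => [|s l IH] x.
  exists 0, x; rewrite add0r; split=> //; first exact: linear_subspace0.
    by move=> y _; rewrite riesz_abs0; apply/meet_l/riesz_abs_ge0.
  by move=> y [].
have [p [c [Bp Cp Cc ->]]] := IH x.
(* Moving [c] by [rho s], splitting along [P] and moving back separates its component in the
   translate of [P] by [s^-1]. *)
have [u [v [Pu Pv uv]]] := Pdec (rho s c).
set C := disjoint_complement (translates P l) in Cp Cc.
set C' := disjoint_complement (translates P (s :: l)).
have C'C y : C' y -> C y.
  by move=> hy z [t tl Pz]; apply: hy; exists t => //; rewrite inE tl orbT.
pose u' := rho s^-1%g u; pose v' := rho s^-1%g v.
have cE : c = u' + v'.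
  by rewrite -(lattice_automorphismD (haut _)) -uv posrepK.
have v'disj y : P (rho s y) -> (riesz_abs v' `&` riesz_abs y)%O = 0.
  move=> Py; apply: (lattice_automorphism_inj (haut s)).
  rewrite (lattice_automorphismI (haut s)) !(lattice_automorphism_abs (haut s)).
  by rewrite posrepVK (lattice_automorphism0 (haut s)); exact: Pv.
have C'u' : disjoint_complement C' u'.
  move=> y C'y; rewrite meetC; apply: C'y; exists s; rewrite ?mem_head//.
  by rewrite posrepVK.
have [linC' _] := disjoint_complement_ideal C'.
exists (p + u'), v'; split.
- by apply: (linear_subspaceD linB) => //; apply: invB; exact: PB.
- by apply: (linear_subspaceD linC') => // y /C'C; exact: Cp.
- move=> y [t]; rewrite inE => /orP[/eqP->|tl] Py; first exact: v'disj.
  have [_ solC] := disjoint_complement_ideal (translates P l).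
  (* Passing from [c] to [v'] only shrinks the absolute value, so disjointness from the earlier
     translates persists. *)
  have hv : C v'.
    apply: (solC _ _ Cc); rewrite cE; apply: disj_abs_le; rewrite meetC.
    by apply: v'disj; rewrite posrepVK.
  by apply: hv; exists t.
- by rewrite -addrA -cE.
Qed.

(** Let [U] be the union of all translates of a nonzero projection band [P] inside [B]. Its
    complement is an invariant projection band and is not [E], since [U] contains [p]; so it is
    zero, and the decomposition places every vector in [B]. *)
Lemma projection_band_irreducible_band : sufficiently_many_projections E ->
  projection_band_irreducible rho -> band_irreducible rho.
Proof.
move=> hE hI B hB invB.
have [->|/eqP B0] := eqVneq B [set 0]%classic; [by left|right].
have [P [hP P0 PB]] := hE B hB B0.
have [[[linP _] _] _] := hP; have [p Pp pn0] := nonzero_in linP P0.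
have := translates_decomposition (enum gT) hB.1 invB hP PB.
set U := translates P (enum gT) => /= dec.
have Up : U p by exists 1%g; rewrite ?mem_enum// posrep1.
have hC : projection_band (disjoint_complement U).
  split=> [|x]; first exact: disjoint_complement_band.
  by have [q [c [_ Cq Cc ->]]] := dec x; exists c, q; rewrite addrC.
have invU : rep_invariant rho U.
  apply/rep_invariantP => s x [t _ Px]; exists (t * s^-1)%g; rewrite ?mem_enum//.
  by rewrite -posrepM// mulgKV.
have [C0|CT] := hI _ hC (disjoint_complement_invariant invU).
  apply/seteqP; split=> // x _; have [q [c [Bq _]]] := dec x.
  by rewrite C0 => -> ->; rewrite addr0.
have : disjoint_complement U p by rewrite CT.
by move=> /(disjoint_self Up).
Qed.

Lemma band_principal_band_irreducible :
  band_irreducible rho -> principal_band_irreducible rho.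
Proof. by move=> hI D [x ->]; apply: hI; have [] := smallest_bandP x. Qed.

(** For nonzero [x] in an invariant summand [L], the sum [u] of the translates of [|x|] over the
    finite group is fixed. The band it generates is invariant, nonzero and contained in the band
    [L]. *)
Lemma principal_band_order_indecomposable :
  principal_band_irreducible rho -> order_indecomposable rho.
Proof.
move=> hI [L [M [hLM /rep_invariantP invL _ L0 LT]]].
have [linL _ _ _ _] := hLM; have [x Lx xn0] := nonzero_in linL L0.
have bandL : band L.
  by rewrite (order_direct_sum_complement hLM); exact: disjoint_complement_band.
pose u := \sum_s rho s (riesz_abs x).
have Lu : L u.
  apply: (big_ind L) => [|y z|s _]; first exact: linear_subspace0.
    exact: linear_subspaceD.
  by apply: invL; exact: (ideal_abs bandL.1).
have xu : riesz_abs x <= u.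
  rewrite /u (bigD1 1%g)//= posrep1 -[leLHS]addr0 rlerD2l.
  apply: (big_ind (fun y => 0 <= y)) => // [|s _]; first exact: raddr_ge0.
  by rewrite (lattice_automorphism_abs (haut s)) riesz_abs_ge0.
have uE s : rho s u = u.
  rewrite /u (big_morph (rho s) (lattice_automorphismD (haut s))
    (lattice_automorphism0 (haut s))).
  rewrite [RHS](reindex_inj (mulgI s)).
  by apply: eq_bigr => t _; rewrite posrepM.
have [hB Bu Bmin] := smallest_bandP u.
have [||B0|BT] := hI (smallest band [set u]%classic).
- by exists u.
- apply/rep_invariantP => s y; apply: (Bmin _ (band_preimage s hB)).
  by rewrite /= uE.
- apply/xn0/riesz_abs_le0; apply: le_trans xu _.
  by move: Bu; rewrite B0 => ->.
- by apply: LT; apply/seteqP; split=> // y _; apply: (Bmin L) => //; rewrite BT.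
Qed.

Lemma ideal_band_irreducible : ideal_irreducible rho -> band_irreducible rho.
Proof. by move=> hI D [hD _]; exact: hI. Qed.

(** * Orbits and the size of disjoint families *)

Lemma band_irreducible_orbit_meet (d y : E) : band_irreducible rho ->
  0 < d -> 0 < y -> exists g, 0 < (y `&` rho g d)%O.
Proof.
move=> hI d0 y0; apply: contrapT => h.
have yd g : (y `&` rho g d)%O = 0.
  apply/eqP; apply: contraT => ygn0; exfalso; apply: h; exists g.
  by rewrite lt_def ygn0 lexI ltW//= ltW// (lattice_automorphism_gt0 (haut g)).
pose U : set E := [set z | exists g, z = rho g d]%classic.
have Ud : U d by exists 1%g; rewrite posrep1.
have invU : rep_invariant rho U.
  by apply/rep_invariantP => s _ [g ->]; exists (s * g)%g; rewrite posrepM.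
have [U0|UT] := hI _ (disjoint_complement_band U)
  (disjoint_complement_invariant invU).
  have : disjoint_complement U y.
    move=> _ [g ->]; rewrite !riesz_abs_ge0_id ?yd ?ltW//.
    by rewrite (lattice_automorphism_gt0 (haut g)).
  by rewrite U0 => yE; rewrite yE ltxx in y0.
have : disjoint_complement U d by rewrite UT.
by move=> /(disjoint_self Ud) dE; rewrite dE ltxx in d0.
Qed.

(* Some [y > 0] lies below a translate of every member of the family, and a
   repeated translating element would put [y] below two disjoint elements. *)
Lemma band_irreducible_disjoint_family k (x : 'I_k -> E) :
  band_irreducible rho -> disjoint_family x -> (k <= #|gT|)%N.
Proof.
move=> hI [x0 xx]; case: k => [//|k] in x x0 xx *.
suff [y [g [y0 yx]]] : exists y (g : 'I_k.+1 -> gT),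
    0 < y /\ {in enum 'I_k.+1, forall i, y <= rho (g i) (x i)}.
  rewrite -[leqLHS]card_ord; apply: (leq_card g) => i j gij.
  apply/eqP; apply: contraT => ij.
  suff yle0 : y <= 0 by move: (lt_le_trans y0 yle0); rewrite ltxx.
  rewrite -(lattice_automorphism0 (haut (g i))) -(xx _ _ ij).
  by rewrite (lattice_automorphismI (haut _)) lexI {2}gij !yx ?mem_enum.
(* The induction may start from [x ord0], as the family is nonempty here; each step replaces [y] by
   its positive meet with a translate of [x i]. *)
elim: (enum _) => [|i l [y [g [y0 yx]]]]; first by exists (x ord0), (fun=> 1%g).
have [h yh] := band_irreducible_orbit_meet hI (x0 i) y0.
exists (y `&` rho h (x i))%O, (fun j => if j == i then h else g j).
split=> // j; rewrite inE; have [->|_/= jl] := eqVneq j i; first by rewrite leIr.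
by apply: le_trans (yx _ jl); exact: leIl.
Qed.

Lemma riesz_atom_image s e : riesz_atom e -> riesz_atom (rho s e).
Proof.
move=> [e0 he]; split; first by rewrite (lattice_automorphism_gt0 (haut s)).
have h y : 0 <= y -> y <= rho s e -> 0 <= rho s^-1%g y /\ rho s^-1%g y <= e.
  move=> y0 ye; split; rewrite -(lattice_automorphism_le (haut s)) posrepVK//.
  by rewrite (lattice_automorphism0 (haut s)).
move=> y z y0 ye z0 ze yz.
have [[y0' ye'] [z0' ze']] := (h _ y0 ye, h _ z0 ze).
have [|h0|h0] := he _ _ y0' ye' z0' ze'.
- by rewrite -(lattice_automorphismI (haut _)) yz (lattice_automorphism0 (haut _)).
- by left; rewrite -(posrepVK s y) h0 (lattice_automorphism0 (haut _)).
- by right; rewrite -(posrepVK s z) h0 (lattice_automorphism0 (haut _)).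
Qed.

(** * The action of the group on the lines spanned by the atoms *)

Section AtomPermutation.
Variables (k : nat) (x : 'I_k -> E).
Hypotheses (hA : archimedean (E := E)) (hI : band_irreducible rho).
Hypotheses (hm : maximal_disjoint_family x) (hx : forall i, riesz_atom (x i)).

(** By maximality the image atom [e] meets some [x j]; the nonzero meet is a multiple of both atoms,
    which makes them proportional. *)
Lemma atom_translate s i : exists j a, 0 < a /\ rho s (x i) = a *: x j.
Proof.
have [[x0 xx] xmax] := hm; have := riesz_atom_image s (hx i).
set e := rho s (x i) => he; have [e0 _] := he.
have [j ejn0] : exists j, (e `&` x j)%O <> 0.
  apply: contrapT => h; have e00 : e = 0.
    apply: xmax; first exact: ltW.
    by move=> j; apply: contrapT => ej; apply: h; exists j.
  by rewrite e00 ltxx in e0.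
have w0 : 0 <= (e `&` x j)%O by rewrite lexI !ltW.
have [a a0 wa] := riesz_atom_le hA he w0 (leIl _ _).
have [b b0 wb] := riesz_atom_le hA (hx j) w0 (leIr _ _).
have an0 : a != 0 by apply/eqP => aE; apply: ejn0; rewrite wa aE scale0r.
have bn0 : b != 0 by apply/eqP => bE; apply: ejn0; rewrite wb bE scale0r.
exists j, (a^-1 * b); split.
  by rewrite mulr_gt0 ?invr_gt0 // lt_neqAle eq_sym ?an0 ?bn0.
by rewrite -scalerA -wb wa scalerA mulVf// scale1r.
Qed.

Lemma atom_scale_inj a b i j : 0 < a -> 0 < b -> a *: x i = b *: x j -> i = j.
Proof.
have [[x0 xx] _] := hm; move=> a0 b0 ab; apply/eqP; apply: contraT => ij.
have ax0 := rscaler_gt0 a0 (x0 i).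
have h : (a *: x i `&` (a *: x i))%O = 0.
  rewrite {2}ab; apply: meetZ_eq0; rewrite ?ltW ?rscaler_gt0//.
  by rewrite meetC; apply: meetZ_eq0; rewrite ?ltW// xx// eq_sym.
by rewrite -h meetxx ltxx in ax0.
Qed.

(* [phi g] is the index of the line containing the image of the first atom
   under [g]; its fibres are the left cosets of a stabilizer. *)
Lemma card_atoms_dvd : (0 < k)%N -> (k %| #|gT|)%N.
Proof.
have [[x0 xx] _] := hm; move=> k0; pose o : 'I_k := Ordinal k0.
have [phi phiP] := choice (fun g => atom_translate g o).
have phiE g a j : 0 < a -> rho g (x o) = a *: x j -> phi g = j.
  move=> a0; have [b [b0 ->]] := phiP g; exact: atom_scale_inj.
(* Transitivity: [x j] meets some translate of the first atom, and that translate is a multiple of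
   [x (phi g)], which is disjoint from [x j] unless [phi g = j]. *)
have phi_surj j : exists g, phi g = j.
  have [g] := band_irreducible_orbit_meet hI (x0 o) (x0 j).
  have [a [a0 ->]] := phiP g => h; exists g; apply/eqP.
  apply: contraLR h => jg; rewrite meetC meetZ_eq0 ?ltxx ?ltW//.
  exact: xx.
pose F j := [set g | phi g == j]%SET.
have cardF j : #|F j| = #|F o|.
  have [h hj] := phi_surj j; have [c [c0 hE]] := phiP h.
  (* [F o] is the stabilizer of the first line, and [h] sends that line to line [j]. *)
  suff -> : F j = (h *: F o)%g by exact: card_lcoset.
  apply/setP => g; rewrite mem_lcoset !inE; apply/eqP/eqP => [gj|].
    have [b [b0 gE]] := phiP g; apply: (phiE _ (c^-1 * b)).
      by rewrite mulr_gt0 ?invr_gt0.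
    apply: (lattice_automorphism_inj (haut h)).
    rewrite -posrepM// mulKVg (lattice_automorphismZ (haut h)) gE hE gj hj.
    by rewrite scalerA mulrAC mulVf ?mul1r// gt_eqF.
  have [b [b0]] := phiP (h^-1 * g)%g => /[swap] -> gE.
  apply: (phiE _ (b * c)); first exact: mulr_gt0.
  rewrite -{1}(mulKVg h g) posrepM// gE (lattice_automorphismZ (haut h)) hE.
  by rewrite scalerA hj.
rewrite -sum1_card (partition_big phi predT)//=.
rewrite (eq_bigr (fun=> #|F o|)) => [|j _]; last first.
  by rewrite -(cardF j) -sum1_card; apply: eq_bigl => g; rewrite inE.
by rewrite sum_nat_const card_ord dvdn_mulr.
Qed.

(** Each atom meets a translate of [|y|] for a nonzero [y] in [J]. The meet lies in [J] and is a
    nonzero multiple of the atom, so [J] contains a basis. *)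
Lemma band_ideal_irreducible : ideal_irreducible rho.
Proof.
move=> J hJ /rep_invariantP invJ; have [linJ _] := hJ.
have [->|/eqP J0] := eqVneq J [set 0]%classic; [by left|right].
have [y Jy yn0] := nonzero_in linJ J0.
have [[x0 xx] _] := hm.
have Jx i : J (x i).
  have [g] := band_irreducible_orbit_meet hI (riesz_abs_gt0 yn0) (x0 i).
  set w := (_ `&` _)%O => w0.
  have Jw : J w.
    apply: (ideal_le hJ (invJ g _ (ideal_abs hJ Jy))) (ltW w0) _; exact: leIr.
  have [a _ wa] := riesz_atom_le hA (hx i) (ltW w0) (leIl _ _).
  have an0 : a != 0 by apply/eqP => aE; rewrite wa aE scale0r ltxx in w0.
  rewrite -[x i]scale1r -(mulVf an0) -scalerA -wa.
  exact: linear_subspaceZ.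
apply/seteqP; split=> // z _; have [c ->] := lincomb_surj hA hm hx z.
apply: (big_ind J) => [|u v|i _]; first exact: linear_subspace0.
  exact: linear_subspaceD.
exact: linear_subspaceZ.
Qed.

End AtomPermutation.

Lemma band_irreducible_atoms : band_irreducible rho ->
  exists k (x : 'I_k -> E),
    maximal_disjoint_family x /\ forall i, riesz_atom (x i).
Proof.
move=> hI; apply: (@exists_maximal_atoms _ _ #|gT|) => k x.
exact: band_irreducible_disjoint_family.
Qed.

End Representation.

(** * Equivalence of the conditions and the dimension *)

Theorem theorem3p16 (R : realType) (E : rieszType R) (gT : finGroupType)
    (rho : gT -> E -> E)
    (hE : sufficiently_many_projections E)
    (hrho : positive_representation rho) :
  [<-> order_indecomposable rho;
       projection_band_irreducible rho;
       band_irreducible rho;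
       ideal_irreducible rho;
       principal_band_irreducible rho] /\
  (order_indecomposable rho ->
   exists2 n : nat, has_dimension E n &
     (exists x : E, x != 0) -> (n %| #|[set: gT]|)%N).
Proof.
have hA := sufficiently_many_projections_archimedean hE.
split.
  tfae.
  - exact: order_indecomposable_projection_band.
  - exact: projection_band_irreducible_band.
  - move=> hI; have [k [x [hm hx]]] := band_irreducible_atoms hrho hI.
    exact: band_ideal_irreducible hA hI hm hx.
  - by move=> /ideal_band_irreducible; exact: band_principal_band_irreducible.
  - exact: principal_band_order_indecomposable.
move=> /(order_indecomposable_projection_band hrho).
move=> /(projection_band_irreducible_band hrho hE) hI.
have [k [x [hm hx]]] := band_irreducible_atoms hrho hI.
exists k; first exact: lincomb_has_dimension hA hm hx.
move=> [y yn0]; rewrite cardsT; apply: (card_atoms_dvd hrho hA hI hm hx).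
(* With [k = 0] every vector is an empty combination, contradicting [y != 0]. *)
case: k => [|//] in x hm hx *; move: yn0.
by have [c ->] := lincomb_surj hA hm hx y; rewrite /lincomb big_ord0 eqxx.
Qed.
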